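(* Let $0<\varepsilon\ll 1$ (i.e. let $\varepsilon>0$ be sufficiently small). For every $\lambda\in(0,1)$ there exists a sequence $\{\varphi_n^{\lambda}\}_{n\in\mathbb{N}}$ of real $1$-periodic trigonometric polynomials $\varphi^\lambda_n:\mathbb{R}\to\mathbb{R}$ with $\int_0^1\varphi_n^\lambda(x)\,dx=0$ such that all $C^0$-invariant graphs of the family $\{F_{\lambda,\alpha}\}_{\alpha\in\mathbb{R}^2}$ are destroyed by perturbing with $\varphi_n^\lambda$, that is: for every $n\in\mathbb{N}$ and every $\alpha=(\alpha_1,\alpha_2)\in\mathbb{R}^2$, the map of $\mathbb{T}\times\mathbb{R}$ induced by $$F^{\flat}_{\lambda,\alpha}(x,y)=\big(x+\alpha_1+\lambda y+\varphi_n^\lambda(x),\ \alpha_2+\lambda y+\varphi_n^\lambda(x)\big)$$ has no $C^0$-invariant graph. Moreover, these sequences satisfy: (I) for each $\lambda\in(0,1)$, the degree $N$ of $\varphi_n^\lambda$ satisfies $N=O(n^{1+\varepsilon})$ as $n\to\infty$; (II) for each $\lambda\in(0,1)$, $\|\varphi_n^\lambda\|_{C^{1-\varepsilon}}=O(n^{-\varepsilon})$ as $n\to\infty$; (III) for every $n\in\mathbb{N}$, $\|\varphi_n^\lambda\|_{C^1}\le 1$ for all $\lambda\in(0,1)$, and $\|\varphi_n^\lambda\|_{C^1}=O(1-\lambda)$ as $\lambda\to1^-$.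
   Context: $\mathbb{T}=\mathbb{R}/\mathbb{Z}$ and $\mathbb N=\{1,2,\dots\}$. For $\lambda\in(0,1)$ and $\alpha=(\alpha_1,\alpha_2)\in\mathbb{R}^2$, the unperturbed (integrable dissipative twist) map is $F_{\lambda,\alpha}:\mathbb{R}^2\to\mathbb{R}^2$, $F_{\lambda,\alpha}(x,y)=(x+\alpha_1+\lambda y,\ \alpha_2+\lambda y)$. For a $1$-periodic function $\varphi$ with zero mean, the perturbed map is $F^\flat_{\lambda,\alpha}(x,y)=(x+\alpha_1+\lambda y+\varphi(x),\alpha_2+\lambda y+\varphi(x))$. Both maps commute with $(x,y)\mapsto(x+1,y)$ and hence induce maps of $\mathbb{T}\times\mathbb{R}$. A $C^0$-invariant graph of a map $f:\mathbb{T}\times\mathbb{R}\to\mathbb{T}\times\mathbb{R}$ is a set $\Gamma=\{(\theta,\psi(\theta)):\theta\in\mathbb{T}\}$, with $\psi:\mathbb{T}\to\mathbb{R}$ continuous, that is invariant under $f$, i.e. $f(\Gamma)=\Gamma$. $\|\cdot\|_{C^1}$ is the usual $C^1$-norm (maximum of the sup norms of the function and its derivative), and $\|\cdot\|_{C^{1-\varepsilon}}$ is the usual Hölder norm with exponent $1-\varepsilon$. The constants implicit in (I) and (II) may depend on $\lambda$ and $\varepsilon$; those in (III) may depend on $n$ and $\varepsilon$. *)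

(* Defs.v *)
From HB Require Import structures.
From mathcomp Require Import all_boot all_order all_algebra generic_quotient.
From mathcomp Require Import all_classical all_reals all_analysis.
Import Order.TTheory GRing.Theory Num.Theory.
Import numFieldNormedType.Exports.

Set Implicit Arguments.
Unset Strict Implicit.
Unset Printing Implicit Defensive.

Local Open Scope classical_set_scope.
Local Open Scope ring_scope.
Local Open Scope quotient_scope.

Definition eqmod1 (R : realType) : rel R := fun x y => x - y \is a Num.int.

Lemma eqmod1_equiv (R : realType) : equiv_class_of (@eqmod1 R).
Proof.
split=> [x|x y|y x z]; rewrite /eqmod1.
- by rewrite subrr rpred0.
- by rewrite -opprB rpredN.
- by move=> xy yz; rewrite -(subrKA y) rpredD.
Qed.

Canonical eqmod1_equivRel (R : realType) := EquivRelPack (eqmod1_equiv R).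

Definition circle (R : realType) : topologicalType :=
  quotient_topology {eq_quot (@eqmod1 R)}.

Definition circle_pi (R : realType) : R -> circle R :=
  \pi_(quotient_topology {eq_quot (@eqmod1 R)}).

Definition circle_repr (R : realType) (t : circle R) : R :=
  repr (t : quotient_topology {eq_quot (@eqmod1 R)}).

Lemma circle_reprK (R : realType) : cancel (@circle_repr R) (@circle_pi R).
Proof. exact: reprK. Qed.

Lemma circle_piP (R : realType) (x y : R) :
  circle_pi x = circle_pi y <-> x - y \is a Num.int.
Proof.
have := @eqquotE _ (@eqmod1 R) {eq_quot (@eqmod1 R)} x y.
rewrite /eqmod1 /= => <-; split=> [/eqP //|/eqP //].
Qed.

Lemma circle_continuous (R : realType) (psi : circle R -> R) :
  continuous psi <-> continuous (psi \o @circle_pi R).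
Proof. exact: quotient_continuous. Qed.

(* Meaningful when F commutes with (x, y) |-> (x + 1, y): see induced_mapE. *)
Definition induced_map (R : realType) (F : R * R -> R * R)
    (z : circle R * R) : circle R * R :=
  let p := F (circle_repr z.1, z.2) in (circle_pi p.1, p.2).

Lemma induced_mapE (R : realType) (F : R * R -> R * R) :
  (forall x y, F (x + 1, y) = ((F (x, y)).1 + 1, (F (x, y)).2)) ->
  forall x y,
    induced_map F (circle_pi x, y) = (circle_pi (F (x, y)).1, (F (x, y)).2).
Proof.
move=> FD x y.
have FDn (n : nat) u : F (u + n%:R, y) = ((F (u, y)).1 + n%:R, (F (u, y)).2).
  elim: n => [|n IHn]; first by rewrite !addr0; case: (F _).
  by rewrite -addn1 natrD !addrA FD IHn.
rewrite /induced_map /=; set u := circle_repr _.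
have /circle_piP : circle_pi u = circle_pi x by exact: circle_reprK.
case/intrP => -[n|n] /eqP; rewrite subr_eq => /eqP uE.
  rewrite uE addrC FDn /=; congr pair.
  by apply/circle_piP; rewrite addrC addKr natr_int.
have -> : x = u + n.+1%:R by rewrite uE NegzE mulrNz addrAC addNr add0r.
rewrite FDn /=; congr pair.
by apply/circle_piP; rewrite opprD addrA subrr sub0r rpredN natr_int.
Qed.

Definition perturbed_map (R : realType) (lambda : R) (alpha : R * R)
    (phi : R -> R) (p : R * R) : R * R :=
  (p.1 + alpha.1 + lambda * p.2 + phi p.1, alpha.2 + lambda * p.2 + phi p.1).

Lemma perturbed_mapD1 (R : realType) (lambda : R) (alpha : R * R)
    (phi : R -> R) : periodic phi 1 -> forall x y,
  perturbed_map lambda alpha phi (x + 1, y) =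
  ((perturbed_map lambda alpha phi (x, y)).1 + 1,
   (perturbed_map lambda alpha phi (x, y)).2).
Proof.
move=> phi1 x y; rewrite /perturbed_map /= phi1; congr pair.
by rewrite -!(addrAC _ 1).
Qed.

Definition is_C0_invariant_graph (R : realType)
    (f : circle R * R -> circle R * R) (Gamma : set (circle R * R)) : Prop :=
  (exists psi : circle R -> R,
     continuous psi /\ Gamma = range (fun t => (t, psi t))) /\
  f @` Gamma = Gamma.

(* The constant term is [a 0]; [b 0] is irrelevant. *)
Definition trig_poly (R : realType) (a b : nat -> R) (N : nat) (x : R) : R :=
  \sum_(k < N.+1) (a k * cos (2 * pi * k%:R * x)
                 + b k * sin (2 * pi * k%:R * x)).

(* N is the exact degree (constants, including 0, have degree 0). *)
Definition is_trig_poly_of_degree (R : realType) (f : R -> R) (N : nat) : Prop :=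
  exists a b : nat -> R,
    f = trig_poly a b N /\ [\/ N = 0%N, a N <> 0 | b N <> 0].

Lemma trig_poly_periodic (R : realType) (f : R -> R) (N : nat) :
  is_trig_poly_of_degree f N -> periodic f 1.
Proof.
case=> a [b [-> _]] x; apply: eq_bigr => k _.
have E : 2 * pi * k%:R * (x + 1) = 2 * pi * k%:R * x + (pi *+ 2) *+ k :> R.
  by rewrite mulrDr mulr1 mulr_natr mulr_natl.
by rewrite E (periodicn (@cosD2pi R)) (periodicn (@sinD2pi R)).
Qed.

(* The suprema below are real-valued, hence equal to the intended ones when the
   sets are bounded (as for a trigonometric polynomial and Hoelder exponents in
   ]0, 1]) and 0 by convention otherwise. *)
Definition sup_norm (R : realType) (f : R -> R) : R :=
  sup (range (fun x => `|f x|)).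

Definition C1_norm (R : realType) (f : R -> R) : R :=
  Num.max (sup_norm f) (sup_norm (f^`())%classic).

Definition holder_seminorm (R : realType) (s : R) (f : R -> R) : R :=
  sup [set q | exists x y, x <> y /\ q = `|f x - f y| / `|x - y| `^ s].

Definition holder_norm (R : realType) (s : R) (f : R -> R) : R :=
  sup_norm f + holder_seminorm s f.

(* Main.v *)
Require Import Defs.
From HB Require Import structures.
From mathcomp Require Import all_boot all_order all_algebra.
From mathcomp Require Import all_classical all_reals all_analysis.
From mathcomp Require Import ring lra.
Import Order.TTheory GRing.Theory Num.Theory.
Import numFieldNormedType.Exports.
Local Open Scope classical_set_scope.
Local Open Scope ring_scope.

(** An invariant graph of the perturbed map carries a circle homeomorphism: if
    [g] is the lift of the first coordinate of the map on the graph and [h] its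
    inverse, eliminating the height [y] from the two coordinates yields
[[
      g x + lambda * h x = (1 + lambda) * x + phi x + const.
]]
    Both summands on the left increase, and their slopes constrain each other:
    a bound [S] on the slopes of [g] bounds those of [h] below by [1 / S], hence
    leaves only [1 + lambda + sup phi' - lambda / S] for [g].  Iterating this
    improvement drives [S] towards the larger fixed point of
    [S |-> 1 + lambda + sup phi' - lambda / S], which is [1] when [sup phi' = 0].
    So if [sup phi'] is small, the slopes of [g] and of [lambda * h] are at most
    about [1], hence at least about [lambda], and the left-hand side has slope at
    least about [2 * lambda].  A single point where [phi'] is somewhat smaller
    than [-(1 - lambda)] therefore rules out every invariant graph, whatever
    [alpha] is ([no_invariant_graph]).

    Such a [phi] is a smoothed sawtooth, climbing slowly and falling steeply on a
    short arc: take [phi' = delta * (1 - K)] with [K] the Fejer kernel of degree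
    [N], which is nonnegative, has mean [1] and culminates at [K 0 = N + 1].
    Then [phi' <= delta], while [phi' 0 = - delta * N].  The depth [delta * N] is
    set to [1 - lambda ^ 2], which exceeds [1 - lambda] but neither [1] nor
    [2 * (1 - lambda)], and [N] is a large multiple of [n], so that [delta] is
    small ([saw_slope_bounds]).  As a periodic function of slope at most [delta]
    that vanishes at [0] is bounded by [delta], the sup norm is [O(1 / n)] while
    the derivative is bounded by [1 - lambda ^ 2]; interpolating between the two
    gives the Hoelder bound ([holder_norm_bounds]). *)

(** * Slopes of increasing functions *)

Definition slope_le {R : realType} (f : R -> R) (S : R) :=
  forall u v, u < v -> f v - f u <= S * (v - u).

Definition slope_ge {R : realType} (f : R -> R) (S : R) :=
  forall u v, u < v -> S * (v - u) <= f v - f u.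

Lemma slope_le_gt0 (R : realType) (f : R -> R) (S : R) :
  {homo f : u v / u < v} -> slope_le f S -> 0 < S.
Proof.
move=> f_incr /(_ 0 1 ltr01); rewrite subr0 mulr1; apply: lt_le_trans.
by rewrite subr_gt0 f_incr.
Qed.

Lemma slope_le_inverse (R : realType) (g h : R -> R) (S : R) :
  0 < S -> {homo h : u v / u < v} -> cancel h g -> slope_le g S ->
  slope_ge h S^-1.
Proof.
move=> S_gt0 h_incr hK gS u v uv.
by have := gS _ _ (h_incr _ _ uv); rewrite !hK ler_pdivrMl.
Qed.

(** If the slopes of [A] and [B] add up to at most [a] and a bound [S] for [A]
    forces slopes [l / S] on [B], then [S] may be replaced by [a - l / S].
    Past [sigma] this gains at least the fixed amount
    [kappa = sigma + l / sigma - a], because [S + l / S] increases with [S]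
    beyond the square root of [l]; finitely many steps lead below [sigma]. *)
Lemma slope_le_contract (R : realType) (A B : R -> R) (a l sigma : R) :
  {homo A : u v / u < v} -> {homo B : u v / u < v} ->
  slope_le (fun x => A x + B x) a ->
  (forall S, 0 < S -> slope_le A S -> slope_ge B (l / S)) ->
  0 < sigma -> l <= sigma ^+ 2 -> a < sigma + l / sigma ->
  exists2 S, S < sigma & slope_le A S.
Proof.
move=> A_incr B_incr ABa AB sigma_gt0 l_le sigma_a.
pose kappa := sigma + l / sigma - a.
have kappa_gt0 : 0 < kappa by rewrite subr_gt0.
have step S : sigma <= S -> slope_le A S -> slope_le A (S - kappa).
  move=> sigmaS AS u v uv.
  have S_gt0 : 0 < S by exact: lt_le_trans sigmaS.
  have := AB S S_gt0 AS u v uv; have := ABa u v uv => /= ABuv Buv.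
  apply: (@le_trans _ _ ((a - l / S) * (v - u))); first by lra.
  apply: ler_wpM2r; first by rewrite subr_ge0 ltW.
  rewrite -subr_ge0 /kappa.
  have -> : S - (sigma + l / sigma - a) - (a - l / S) =
            (S - sigma) * (S * sigma - l) / (S * sigma).
    by field; rewrite !gt_eqF.
  have l_leS : l <= S * sigma.
    by rewrite (le_trans l_le)// expr2 ler_wpM2r// ltW.
  by rewrite divr_ge0// mulr_ge0 ?subr_ge0// ltW.
have descent n S : slope_le A S -> S < sigma + n%:R * kappa ->
    exists2 S', S' < sigma & slope_le A S'.
  elim: n S => [|n IHn] S AS Sn.
    by exists S => //; rewrite mul0r addr0 in Sn.
  have [S_lt|sigmaS] := ltP S sigma; first by exists S.
  apply: IHn (step _ sigmaS AS) _.
  by rewrite -natr1 mulrDl mul1r in Sn; lra.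
have Aa : slope_le A a.
  move=> u v uv; have := ABa u v uv; have := B_incr u v uv => /= *; lra.
apply: (descent (Num.trunc (a / kappa)).+1 a Aa).
have := truncnS_gt (a / kappa); rewrite ltr_pdivrMr// => a_lt; lra.
Qed.

Lemma is_derive_continuous (R : realType) (f df : R -> R) :
  (forall t : R, is_derive t 1 f (df t)) -> continuous f.
Proof.
move=> f_df x; apply/differentiable_continuous/derivable1_diffP.
by have [] := f_df x.
Qed.

Lemma derive_slope_le (R : realType) (f df : R -> R) (S : R) :
  (forall t : R, is_derive t 1 f (df t)) -> (forall t, df t <= S) ->
  slope_le f S.
Proof.
move=> f_df df_le u v uv.
have [|w _ ->] := MVT uv (fun x _ => f_df x).
  exact/continuous_subspaceT/(is_derive_continuous _ _ _ f_df).
by rewrite ler_wpM2r// subr_ge0 ltW.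
Qed.

Lemma derive_lipschitz (R : realType) (f df : R -> R) (S : R) :
  (forall t : R, is_derive t 1 f (df t)) -> (forall t, `|df t| <= S) ->
  forall u v, `|f u - f v| <= S * `|u - v|.
Proof.
move=> f_df df_le u v.
wlog uv : u v / u < v => [H|].
  have [/H//|/H|->] := ltgtP u v; first by rewrite distrC (distrC v).
  by rewrite !subrr normr0 mulr0.
rewrite distrC (distrC u).
have [|w _ ->] := MVT uv (fun x _ => f_df x).
  exact/continuous_subspaceT/(is_derive_continuous _ _ _ f_df).
by rewrite normrM ler_wpM2r.
Qed.

(** [f] minus a line of slope strictly between [df x] and [c] would be increasing
    with a negative derivative at [x]. *)
Lemma slope_ge_derive (R : realType) (f df : R -> R) (c x : R) :
  (forall t : R, is_derive t 1 f (df t)) -> slope_ge f c -> c <= df x.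
Proof.
move=> f_df fc; rewrite leNgt; apply/negP => dc.
pose k := (c + df x) / 2; pose F t := f t - k * t.
have F_dF (t : R) : is_derive t 1 F (df t - k).
  rewrite (_ : F = f - (k \*: id))//; apply: is_derive_eq.
  by rewrite [_ *: _]mulr1.
have := @incr_derive1_ge0 _ F setT x _ _ _.
rewrite derive1E derive_val interiorT => F_ge0.
have : 0 <= df x - k.
  apply: F_ge0 => // u v _ _ uv.
  have := fc u v uv; rewrite /F -subr_gt0 => fuv.
  apply: lt_le_trans (_ : (c - k) * (v - u) <= _); last by lra.
  by rewrite mulr_gt0 ?subr_gt0// /k; lra.
by rewrite /k; lra.
Qed.

(** * The circle homeomorphism carried by an invariant graph *)

Lemma periodic_int (R : realType) (f : R -> R) (x k : R) :
  periodic f 1 -> k \is a Num.int -> f (x + k) = f x.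
Proof.
move=> f1 /intrP[[n|n] ->]; first by rewrite (periodicn f1).
by rewrite NegzE mulrNz -[in RHS](subrK n.+1%:R x) (periodicn f1).
Qed.

Lemma continuous_inj_increasing (R : realType) (g : R -> R) :
  continuous g -> injective g -> (forall x, g (x + 1) = g x + 1) ->
  {homo g : u v / u < v}.
Proof.
move=> g_cont g_inj gD1.
have [||gm|gm] := @itv_continuous_inj_mono R g `]-oo, +oo[.
- exact: continuous_subspaceT.
- by move=> u v _ _; exact: g_inj.
- by move=> u v uv; rewrite gm.
have g1 : g 1 = g 0 + 1 by rewrite -gD1 add0r.
have := gm 1 0 isT isT ltr01.
by rewrite g1 gtrDl ltr10.
Qed.

(** With [Psi] the lift of the graph, subtracting the two coordinates of the map
    gives [Psi (g x) = g x - x + (alpha.2 - alpha.1)].  So [g] has the explicit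
    left inverse [h x = x + (alpha.2 - alpha.1) - Psi x], and adding
    [lambda * h x] to [g x] cancels [Psi].  That [g] is onto is the inclusion of
    the graph in its image. *)
Lemma invariant_graph_conjugacy (R : realType) (lambda : R) (alpha : R * R)
    (phi : R -> R) (Gamma : set (circle R * R)) :
  continuous phi -> periodic phi 1 ->
  is_C0_invariant_graph (induced_map (perturbed_map lambda alpha phi)) Gamma ->
  exists g h : R -> R,
    [/\ {homo g : u v / u < v}, {homo h : u v / u < v}, cancel g h, cancel h g &
      exists c, forall x, g x + lambda * h x = (1 + lambda) * x + phi x + c].
Proof.
move=> phi_cont phi1 [[psi [psi_cont ->]] inv].
pose Psi x := psi (circle_pi x); pose c := alpha.2 - alpha.1.
have Psi_int x k : k \is a Num.int -> Psi (x + k) = Psi x.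
  move=> kZ; congr psi; apply/circle_piP.
  by rewrite addrC addKr.
pose g x := x + alpha.1 + lambda * Psi x + phi x.
pose h x := x + c - Psi x.
have FE x : induced_map (perturbed_map lambda alpha phi) (circle_pi x, Psi x) =
    (circle_pi (g x), alpha.2 + lambda * Psi x + phi x).
  by rewrite induced_mapE//; exact: perturbed_mapD1.
have PsigE x : Psi (g x) = alpha.2 + lambda * Psi x + phi x.
  have : (range (fun t => (t, psi t)))
      (induced_map (perturbed_map lambda alpha phi) (circle_pi x, Psi x)).
    by rewrite -[X in X _]inv; exists (circle_pi x, Psi x).
  by rewrite FE => -[t _ [tE <-]]; rewrite tE.
have gK : cancel g h.
  by move=> x; rewrite /h PsigE /g /c; ring.
have g_int x k : k \is a Num.int -> g (x + k) = g x + k.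
  by move=> kZ; rewrite /g Psi_int// periodic_int//; ring.
have hK : cancel h g.
  move=> x.
  have : (range (fun t => (t, psi t))) (circle_pi x, Psi x).
    by exists (circle_pi x).
  rewrite -[X in X _]inv => -[_ [t _ <-]].
  rewrite -(circle_reprK t) -/(Psi _) FE => -[/esym/circle_piP xgZ _].
  have -> : x = g (circle_repr t + (x - g (circle_repr t))).
    by rewrite g_int//; ring.
  by rewrite gK.
have Psi_cont : continuous Psi by exact/circle_continuous.
have g_cont : continuous g.
  move=> x; rewrite /g; apply: cvgD; last exact: phi_cont.
  by apply: cvgD; [apply: cvgD; [exact: cvg_id|exact: cvg_cst]|
    apply: cvgM; [exact: cvg_cst|exact: Psi_cont]].
have g_incr : {homo g : u v / u < v}.
  apply: continuous_inj_increasing => // [|x]; last exact: g_int.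
  exact: can_inj gK.
have h_incr : {homo h : u v / u < v}.
  move=> u v uv; rewrite ltNge; apply/negP.
  rewrite le_eqVlt => /orP[/eqP E|/g_incr].
    by move: uv; rewrite -(hK u) -(hK v) E ltxx.
  by rewrite !hK => /(lt_trans uv); rewrite ltxx.
exists g, h; split => //; exists (alpha.1 + lambda * c) => x.
by rewrite /g /h; ring.
Qed.

(** The threshold [sigma = 2 / (1 + lambda)] is chosen so that
    [2 * (lambda / sigma) = lambda * (1 + lambda)], which is the slope of
    [(1 + lambda) * x + phi x] where [phi] descends with slope
    [-(1 - lambda ^ 2)].  The condition on [delta] says that
    [1 + lambda + delta < sigma + lambda / sigma]; it makes the slopes of [g] and
    of [lambda * h] strictly smaller than [sigma], hence strictly larger than
    [lambda / sigma]. *)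
Lemma no_invariant_graph (R : realType) (lambda delta : R) (phi dphi : R -> R)
    (alpha : R * R) (Gamma : set (circle R * R)) :
  0 < lambda < 1 -> periodic phi 1 ->
  (forall x : R, is_derive x 1 phi (dphi x)) ->
  (forall x, dphi x <= delta) -> (exists x, dphi x = - (1 - lambda ^+ 2)) ->
  2 * (1 + lambda) * delta < (1 - lambda) ^+ 2 * (2 + lambda) ->
  ~ is_C0_invariant_graph (induced_map (perturbed_map lambda alpha phi)) Gamma.
Proof.
move=> /andP[l0 l1] phi1 phi_dphi dphi_le [x0 dphi_x0] delta_lt.
have phi_cont := is_derive_continuous _ _ _ phi_dphi.
case/(invariant_graph_conjugacy _ _ _ _ _ phi_cont phi1)=> g [h].
move=> [g_incr h_incr gK hK [c ghE]].
pose L x := (1 + lambda) * x + phi x + c.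
have L_dL (x : R) : is_derive x 1 L (1 + lambda + dphi x).
  rewrite (_ : L = ((1 + lambda) \*: id) + phi + cst c)//; apply: is_derive_eq.
  by rewrite [_ *: _]mulr1 addr0.
pose k x := lambda * h x.
have k_incr : {homo k : u v / u < v} by move=> u v /h_incr; rewrite /k ltr_pM2l.
have LE : L = fun x => g x + k x by apply/funext => x; rewrite /L -ghE.
have L_le : slope_le L (1 + lambda + delta).
  by apply: derive_slope_le L_dL _ => t; rewrite lerD2l.
have gk S : 0 < S -> slope_le g S -> slope_ge k (lambda / S).
  move=> S_gt0 gS u v uv.
  have := slope_le_inverse _ g h S S_gt0 h_incr hK gS u v uv.
  by rewrite /k -mulrBr -mulrA ler_pM2l.
have kg S : 0 < S -> slope_le k S -> slope_ge g (lambda / S).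
  move=> S_gt0 kS.
  rewrite -[lambda / S]invrK invf_div.
  apply: (slope_le_inverse _ h g) => // [|u v uv]; first by rewrite divr_gt0.
  by have := kS u v uv; rewrite /k -mulrBr mulrAC ler_pdivlMr// mulrC.
pose sigma := 2 / (1 + lambda).
have sigma_gt0 : 0 < sigma by rewrite divr_gt0; lra.
have l_le : lambda <= sigma ^+ 2.
  rewrite (le_trans (ltW l1))// -[1](expr1n _ 2%N) lerXn2r ?nnegrE ?ltW//.
  by rewrite /sigma ltr_pdivlMr; lra.
have sigmaE : lambda / sigma = lambda * (1 + lambda) / 2.
  by rewrite /sigma; field; rewrite gt_eqF//; lra.
have sigma_lt : 1 + lambda + delta < sigma + lambda / sigma.
  rewrite sigmaE /sigma -subr_gt0.
  (* [4 + lambda * t ^ 2 - 2 * t ^ 2] factors as [(2 - t) ^ 2 * (1 + t)] for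
     [t = 1 + lambda]. *)
  have -> : 2 / (1 + lambda) + lambda * (1 + lambda) / 2 - (1 + lambda + delta) =
      ((1 - lambda) ^+ 2 * (2 + lambda) - 2 * (1 + lambda) * delta)
      / (2 * (1 + lambda)).
    by field; rewrite gt_eqF//; lra.
  by rewrite divr_gt0 ?subr_gt0// mulr_gt0; lra.
rewrite LE in L_le.
have [S S_lt gS] := slope_le_contract _ g k _ _ _ g_incr k_incr L_le gk
  sigma_gt0 l_le sigma_lt.
have kgL : slope_le (fun x => k x + g x) (1 + lambda + delta).
  by move=> u v uv; have := L_le u v uv; rewrite /= ![g _ + _]addrC.
have [T T_lt kT] := slope_le_contract _ k g _ _ _ k_incr g_incr kgL kg
  sigma_gt0 l_le sigma_lt.
have S_gt0 := slope_le_gt0 _ _ _ g_incr gS.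
have T_gt0 := slope_le_gt0 _ _ _ k_incr kT.
have L_ge : slope_ge L (lambda / S + lambda / T).
  move=> u v uv; have := gk S S_gt0 gS u v uv; have := kg T T_gt0 kT u v uv.
  by rewrite LE /=; lra.
have := slope_ge_derive _ _ _ _ x0 L_dL L_ge; rewrite dphi_x0.
have : lambda / sigma < lambda / S by rewrite ltr_pM2l// ltf_pV2 ?posrE.
have : lambda / sigma < lambda / T by rewrite ltr_pM2l// ltf_pV2 ?posrE.
rewrite sigmaE; lra.
Qed.

(** * Trigonometric polynomials and the Fejer kernel *)

Lemma is_derive_trig_poly (R : realType) (a b : nat -> R) (N : nat) (x : R) :
  is_derive x 1 (trig_poly a b N)
    (trig_poly (fun k => 2 * pi * k%:R * b k)
               (fun k => - (2 * pi * k%:R * a k)) N x).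
Proof.
rewrite (_ : trig_poly a b N = \sum_(k < N.+1)
    ((a k \*: (cos \o ((2 * pi * k%:R) \*: id))) +
     (b k \*: (sin \o ((2 * pi * k%:R) \*: id))))); last first.
  by apply/funext => t; rewrite fct_sumE.
apply: is_derive_sum => k; apply: is_derive_eq.
by rewrite /= /GRing.scale /=; ring.
Qed.

Lemma trig_poly_continuous (R : realType) (a b : nat -> R) (N : nat) :
  continuous (trig_poly a b N).
Proof.
exact: is_derive_continuous (is_derive_trig_poly R a b N).
Qed.

Lemma Rintegral_trig_poly (R : realType) (a b : nat -> R) (N : nat) : a 0%N = 0 ->
  (\int[lebesgue_measure]_(x in `[0, 1]) trig_poly a b N x)%R = 0.
Proof.
move=> a0.
pose F := trig_poly (fun k => - (b k / (2 * pi * k%:R)))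
                    (fun k => a k / (2 * pi * k%:R)) N.
have F_dF x := is_derive_trig_poly R (fun k => - (b k / (2 * pi * k%:R)))
  (fun k => a k / (2 * pi * k%:R)) N x.
have dF x : 'D_1 F x = trig_poly a b N x.
  have /@derive_val -> := F_dF x.
  apply: eq_bigr => -[[|k] /= _] _.
    by rewrite a0 !(mulr0, mul0r, sin0, oppr0).
  have pk : 2 * pi * k.+1%:R != 0 :> R by rewrite !mulf_neq0// gt_eqF// pi_gt0.
  by rewrite mulrN opprK ![2 * pi * _ * (_ / _)]mulrC !divfK.
have F_cont : continuous F by exact: trig_poly_continuous.
have F01 : F 1 = F 0.
  apply: eq_bigr => k _; rewrite mulr1 mulr0.
  have -> : 2 * pi * k%:R = 0 + (pi *+ 2) *+ k :> R.
    by rewrite add0r mulr_natr mulr_natl.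
  by rewrite (periodicn (@cosD2pi R)) (periodicn (@sinD2pi R)).
rewrite /Rintegral (@continuous_FTC2 R _ F) ?F01 ?subee//.
- exact/continuous_subspaceT/trig_poly_continuous.
- split.
  + by move=> x _; have [] := F_dF x.
  + exact/cvg_at_right_filter/F_cont.
  + exact/cvg_at_left_filter/F_cont.
- by move=> x _; rewrite derive1E.
Qed.

(** This is [n] times the identity between the two forms of the Fejer kernel,
    as a cosine sum with triangular weights and as a squared modulus; the last
    [n] is there because the sum counts its constant term twice.  Passing
    from [n] to [n + 1] adds twice a sum of [cos (k * t)] to either side: on the
    right it comes from the product of the new term with the older ones and the
    cosine subtraction formula. *)
Lemma fejer_sum (R : realType) (n : nat) (t : R) :
  \sum_(k < n) (n - k)%:R * 2 * cos (k%:R * t) =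
  (\sum_(k < n) cos (k%:R * t)) ^+ 2 + (\sum_(k < n) sin (k%:R * t)) ^+ 2 + n%:R.
Proof.
elim: n => [|n IHn]; first by rewrite !big_ord0 expr0n/= !addr0.
have -> : \sum_(k < n.+1) (n.+1 - k)%:R * 2 * cos (k%:R * t) =
    \sum_(k < n) (n - k)%:R * 2 * cos (k%:R * t)
    + 2 * \sum_(k < n.+1) cos (k%:R * t).
  rewrite [in RHS]mulr_sumr !big_ord_recr/= subSnn addrA -big_split/=.
  congr (_ + _); last by ring.
  apply: eq_bigr => k _; rewrite subSn; last exact: ltnW.
  by rewrite -natr1; ring.
rewrite IHn ![in RHS]big_ord_recr/=.
have -> : \sum_(k < n.+1) cos (k%:R * t) = 1 +
    ((\sum_(k < n) cos (k%:R * t)) * cos (n%:R * t)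
     + (\sum_(k < n) sin (k%:R * t)) * sin (n%:R * t)).
  rewrite big_ord_recl /= mul0r cos0; congr (_ + _).
  rewrite (reindex_inj rev_ord_inj)/= !mulr_suml -big_split/=.
  apply: eq_bigr => k _.
  rewrite /bump/= add1n subnSK// natrB 1?ltnW// mulrBl cosB; ring.
rewrite !sqrrD -(natr1 n) [sin (n%:R * t) ^+ 2]sin2cos2; ring.
Qed.

(** The primitive of [delta * (1 - K)] without constant term, where [K] is the
    Fejer kernel of degree [N]. *)
Definition fejer_saw {R : realType} (delta : R) (N : nat) : R -> R :=
  trig_poly (fun=> 0)
    (fun k => - (delta * ((N.+1 - k)%:R * 2) / N.+1%:R / (2 * pi * k%:R))) N.

(** The derivative, with the kernel as a squared modulus so that its sign
    shows. *)
Definition fejer_saw' {R : realType} (delta : R) (N : nat) (x : R) : R :=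
  delta - delta / N.+1%:R *
    ((\sum_(k < N.+1) cos (k%:R * (2 * pi * x))) ^+ 2
     + (\sum_(k < N.+1) sin (k%:R * (2 * pi * x))) ^+ 2).

Lemma is_derive_fejer_saw (R : realType) (delta : R) (N : nat) (x : R) :
  is_derive x 1 (fejer_saw delta N) (fejer_saw' delta N x).
Proof.
apply: (@is_derive_eq _ _ _ _ _ _ _ _ (is_derive_trig_poly _ _ _ _ _)).
have N0 : N.+1%:R != 0 :> R by rewrite pnatr_eq0.
have -> : fejer_saw' delta N x = - (delta / N.+1%:R) *
    (\sum_(k < N.+1) (N.+1 - k)%:R * 2 * cos (k%:R * (2 * pi * x)) - N.+1%:R * 2).
  by rewrite fejer_sum /fejer_saw'; field.
rewrite /trig_poly !big_ord_recl/= subn0.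
rewrite !mulr0 !mul0r cos0 oppr0 !mul0r !add0r mulr1.
rewrite [in RHS]addrAC subrr add0r mulr_sumr; apply: eq_bigr => k _.
rewrite mulr0 oppr0 mul0r addr0 (_ : bump 0 k = k.+1)//.
rewrite [k.+1%:R * _]mulrC [2 * pi * x * _]mulrAC.
have k0 : k.+1%:R != 0 :> R by rewrite pnatr_eq0.
have p0 : pi != 0 :> R by rewrite gt_eqF ?pi_gt0.
move: p0; generalize (pi : R) => p p0.
by field; rewrite p0 !nat1r !pnatr_eq0.
Qed.

Lemma fejer_saw'_le (R : realType) (delta : R) (N : nat) (x : R) :
  0 <= delta -> fejer_saw' delta N x <= delta.
Proof.
by move=> d0; rewrite gerBl mulr_ge0 ?divr_ge0 ?addr_ge0 ?sqr_ge0.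
Qed.

Lemma fejer_saw'0 (R : realType) (delta : R) (N : nat) :
  fejer_saw' delta N 0 = - (delta * N%:R).
Proof.
rewrite /fejer_saw'.
under eq_bigr do rewrite !mulr0 cos0.
under [X in _ + X ^+ 2]eq_bigr do rewrite !mulr0 sin0.
rewrite sumr_const big1// card_ord expr0n addr0 -[1 *+ N.+1]/(N.+1%:R) -(natr1 N).
by field; rewrite natr1 pnatr_eq0.
Qed.

(** In its form as a cosine sum, the kernel is largest at [0]. *)
Lemma fejer_saw'_ge (R : realType) (delta : R) (N : nat) (x : R) :
  0 <= delta -> - (delta * N%:R) <= fejer_saw' delta N x.
Proof.
move=> d0; rewrite -fejer_saw'0 lerD2l lerN2 ler_wpM2l ?divr_ge0//.
rewrite -(lerD2r N.+1%:R) -!fejer_sum; apply: ler_sum => k _.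
by rewrite ler_wpM2l ?mulr_ge0// !mulr0 cos0 cos_le1.
Qed.

Lemma fejer_saw_degree (R : realType) (delta : R) (N : nat) :
  delta != 0 -> is_trig_poly_of_degree (fejer_saw delta N) N.
Proof.
move=> d0; eexists; eexists; split; first reflexivity.
case: N => [|N]; first by constructor 1.
constructor 3; apply/eqP; rewrite oppr_eq0 subSnn mul1r.
by rewrite !(mulf_neq0, invr_neq0)// ?gt_eqF// pi_gt0.
Qed.

Lemma fejer_saw0 (R : realType) (delta : R) (N : nat) : fejer_saw delta N 0 = 0.
Proof. by apply: big1 => k _; rewrite mulr0 sin0 !(mul0r, mulr0) addr0. Qed.

(** * Norm estimates *)

(** [f] vanishes at the integers on both sides of [x]: the slope bound controls
    the rise of [f] from the left one to [x] and from [x] to the right one. *)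
Lemma periodic_slope_bounded (R : realType) (f : R -> R) (S : R) :
  0 <= S -> periodic f 1 -> f 0 = 0 -> slope_le f S -> forall x, `|f x| <= S.
Proof.
move=> S0 f1 f0 fS x.
have f_int k : k \is a Num.int -> f k = 0.
  by move=> kZ; rewrite -[k]add0r periodic_int.
have slope u v : u <= v -> v <= u + 1 -> f v - f u <= S.
  rewrite le_eqVlt => /predU1P[-> _|uv v1]; first by rewrite subrr.
  apply: le_trans (fS u v uv) _.
  by rewrite -[leRHS]mulr1 ler_wpM2l// lerBlDl.
have /andP[kx xk] := floor_itv x.
have := slope _ _ kx.
rewrite (f_int (Num.floor x)%:~R) ?intr_int// subr0 -intrD1 => fx.
have := slope _ _ (ltW xk).
rewrite (f_int (Num.floor x + 1)%:~R) ?intr_int// sub0r intrD1 lerD2r => fxN.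
by rewrite ler_norml lerNl fxN// fx// ltW.
Qed.

Lemma sup_norm_bounds (R : realType) (f : R -> R) (B : R) :
  (forall x, `|f x| <= B) -> 0 <= sup_norm f <= B.
Proof.
move=> fB; apply/andP; split; last first.
  by apply: ge_sup => [|_ [x _ <-]//]; exists `|f 0|, 0.
apply: le_trans (normr_ge0 (f 0)) _.
by apply: ub_le_sup; [exists B => _ [x _ <-]|exists 0].
Qed.

Lemma C1_norm_bounds (R : realType) (f df : R -> R) (B : R) :
  (forall t : R, is_derive t 1 f (df t)) ->
  (forall x, `|f x| <= B) -> (forall x, `|df x| <= B) ->
  0 <= C1_norm f <= B.
Proof.
move=> f_df fB dfB; rewrite /C1_norm.
have -> : (f^`())%classic = df by apply/funext => x; rewrite derive1E derive_val.
have /andP[f0 fB'] := sup_norm_bounds _ _ _ fB.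
have /andP[df0 dfB'] := sup_norm_bounds _ _ _ dfB.
by rewrite le_max ge_max f0 fB' dfB'.
Qed.

(** Interpolation: in [|f x - f y| = |f x - f y| `^ s * |f x - f y| `^ (1 - s)]
    the first factor is estimated by the Lipschitz bound, the second by the sup
    norm. *)
Lemma holder_norm_bounds (R : realType) (f : R -> R) (L B s : R) :
  0 <= s <= 1 -> 0 <= L ->
  (forall x, `|f x| <= B) -> (forall x y, `|f x - f y| <= L * `|x - y|) ->
  0 <= holder_norm s f <= B + L `^ s * (2 * B) `^ (1 - s).
Proof.
move=> /andP[s0 s1] L0 fB fL.
have /andP[f0 fB'] := sup_norm_bounds _ _ _ fB.
have s1' : 0 <= 1 - s by rewrite subr_ge0.
have B0 : 0 <= B := le_trans (normr_ge0 (f 0)) (fB 0).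
have quotB x y : x <> y ->
    `|f x - f y| / `|x - y| `^ s <= L `^ s * (2 * B) `^ (1 - s).
  move=> /eqP xy; have xy0 : 0 < `|x - y| by rewrite normr_gt0 subr_eq0.
  rewrite ler_pdivrMr ?powR_gt0// mulrAC -powRM//.
  have -> : `|f x - f y| = `|f x - f y| `^ s * `|f x - f y| `^ (1 - s).
    by rewrite -powRD (addrC s) subrK ?powRr1// oner_eq0.
  apply: ler_pM; rewrite ?powR_ge0// ge0_ler_powR ?nnegrE ?mulr_ge0//.
  by rewrite (le_trans (ler_normB _ _))// mulr_natl mulr2n lerD.
rewrite /holder_norm /holder_seminorm.
set Q := [set q | _].
have Qub : has_ubound Q.
  exists (L `^ s * (2 * B) `^ (1 - s)) => _ [x [y [xy ->]]]; exact: quotB.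
have Q01 : Q (`|f 0 - f 1| / `|0 - 1| `^ s).
  by exists 0, 1; split => // /eqP; rewrite eq_sym oner_eq0.
apply/andP; split.
  apply: addr_ge0 => //; apply: le_trans (ub_le_sup Qub Q01).
  by rewrite divr_ge0 ?powR_ge0.
apply: lerD => //; apply: ge_sup => [|_ [x [y [xy ->]]]]; last exact: quotB.
by exists (`|f 0 - f 1| / `|0 - 1| `^ s).
Qed.

(** * The perturbations *)

(** The factor [4 / (1 - lambda)] is what the smallness condition of
    [no_invariant_graph] on [delta] requires. *)
Definition saw_degree {R : realType} (lambda : R) (n : nat) : nat :=
  (n * (Num.trunc (4 / (1 - lambda))).+1)%N.

(** The climbing slope for which the steepest descent is [1 - lambda ^ 2]. *)
Definition saw_slope {R : realType} (lambda : R) (n : nat) : R :=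
  (1 - lambda ^+ 2) / (saw_degree lambda n)%:R.

Lemma saw_slope_bounds (R : realType) (lambda : R) (n : nat)
    (N := saw_degree lambda n) (delta := saw_slope lambda n) :
  0 < lambda < 1 -> (0 < n)%N ->
  [/\ 0 < delta, delta * N%:R = 1 - lambda ^+ 2, delta <= 1 - lambda ^+ 2,
      delta <= n%:R^-1
    & 2 * (1 + lambda) * delta < (1 - lambda) ^+ 2 * (2 + lambda)].
Proof.
move=> /andP[l0 l1] n0.
have m0 : 0 < 1 - lambda ^+ 2 by rewrite subr_gt0 exprn_ilt1// ltW.
have n1 : 1 <= n%:R :> R by rewrite ler1n.
have nN : n%:R <= N%:R :> R by rewrite ler_nat leq_pmulr.
have N_ge : 4 / (1 - lambda) < N%:R.
  by apply: lt_le_trans (truncnS_gt _) _; rewrite ler_nat leq_pmull.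
have N_gt0 : 0 < N%:R :> R by rewrite (lt_le_trans _ nN)// (lt_le_trans _ n1).
have dE : delta = (1 - lambda ^+ 2) / N%:R by [].
have dN : delta * N%:R = 1 - lambda ^+ 2 by rewrite dE divfK// gt_eqF.
split=> //.
- by rewrite dE divr_gt0.
- by rewrite dE ler_pdivrMr// ler_peMr ?(le_trans n1)// ltW.
- rewrite dE ler_pdivrMr// (@le_trans _ _ 1)//; first by rewrite gerBl sqr_ge0.
  by rewrite mulrC ler_pdivlMr ?mul1r// (lt_le_trans _ n1).
- rewrite -(ltr_pM2r N_gt0) -[ltLHS]mulrA dN.
  move: N_ge; rewrite ltr_pdivrMr ?subr_gt0// => N_ge.
  (* Multiplied by [N], the claim has [2 * (1 + lambda) * (1 - lambda ^ 2)] on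
     the left, and [N * (1 - lambda) > 4]. *)
  rewrite mulrAC -mulrA.
  apply: (@lt_le_trans _ _ ((1 - lambda) * (2 + lambda) * 4)); last by nra.
  rewrite -subr_gt0 (_ : _ - _ =
    2 * (1 - lambda) * (2 * (2 + lambda) - (1 + lambda) ^+ 2)); last by ring.
  by rewrite mulr_gt0//; nra.
Qed.

Definition saw {R : realType} (lambda : R) (n : nat) : R -> R :=
  fejer_saw (saw_slope lambda n) (saw_degree lambda n).

Lemma saw_bounds (R : realType) (lambda : R) (n : nat)
    (delta := saw_slope lambda n) (m := 1 - lambda ^+ 2) :
  0 < lambda < 1 -> (0 < n)%N ->
  [/\ periodic (saw lambda n) 1,
      forall x, `|saw lambda n x| <= delta
    & forall x, `|fejer_saw' delta (saw_degree lambda n) x| <= m].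
Proof.
move=> l01 n0; have [d0 dN dm _ _] := saw_slope_bounds R lambda n l01 n0.
have saw1 : periodic (saw lambda n) 1.
  by apply/trig_poly_periodic/fejer_saw_degree; rewrite gt_eqF.
split=> // x.
  apply: periodic_slope_bounded saw1 _ _ x; [exact: ltW|exact: fejer_saw0|].
  apply: derive_slope_le (is_derive_fejer_saw _ _ _) _ => t.
  exact/fejer_saw'_le/ltW.
rewrite ler_norml; apply/andP; split.
  by rewrite /m -dN fejer_saw'_ge// ltW.
by apply: le_trans dm; exact/fejer_saw'_le/ltW.
Qed.

Theorem theorem1 (R : realType) :
  exists eps0 : R, 0 < eps0 <= 1 /\
  forall eps : R, 0 < eps < eps0 ->
  exists (phi : R -> nat -> R -> R) (deg : R -> nat -> nat),
    (forall (lambda : R) (n : nat), 0 < lambda < 1 -> (0 < n)%N ->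
      [/\ is_trig_poly_of_degree (phi lambda n) (deg lambda n),
          (\int[lebesgue_measure]_(x in `[0, 1]) phi lambda n x)%R = 0
        & forall alpha : R * R,
            ~ exists Gamma : set (circle R * R),
                is_C0_invariant_graph
                  (induced_map (perturbed_map lambda alpha (phi lambda n)))
                  Gamma]) /\
    [/\ forall lambda : R, 0 < lambda < 1 ->
          (fun n : nat => (deg lambda n)%:R : R)
            =O_\oo (fun n : nat => n%:R `^ (1 + eps)),
        forall lambda : R, 0 < lambda < 1 ->
          (fun n : nat => holder_norm (1 - eps) (phi lambda n))
            =O_\oo (fun n : nat => n%:R `^ (- eps))
      & forall n : nat, (0 < n)%N ->
          (forall lambda : R, 0 < lambda < 1 -> C1_norm (phi lambda n) <= 1) /\
          (fun lambda : R => C1_norm (phi lambda n))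
            =O_ ((1 : R)^'-) (fun lambda : R => 1 - lambda)].
Proof.
exists 1; split; first by rewrite ltr01 lexx.
move=> eps /andP[eps0 eps1]; exists saw, saw_degree.
have C1 (lambda : R) n : 0 < lambda < 1 -> (0 < n)%N ->
    0 <= C1_norm (saw lambda n) <= 1 - lambda ^+ 2.
  move=> l01 n0; have [_ _ dm _ _] := saw_slope_bounds R lambda n l01 n0.
  have [_ sawB saw'B] := saw_bounds R lambda n l01 n0.
  apply: C1_norm_bounds (is_derive_fejer_saw _ _ _) _ saw'B => x.
  exact: le_trans (sawB x) dm.
split=> [lambda n l01 n0|].
  have [d0 dN dm dn d_lt] := saw_slope_bounds R lambda n l01 n0.
  have [saw1 _ _] := saw_bounds R lambda n l01 n0.
  split=> [||alpha [Gamma]]; first by apply: fejer_saw_degree; rewrite gt_eqF.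
    exact: Rintegral_trig_poly.
  apply: no_invariant_graph (is_derive_fejer_saw _ _ _) _ _ d_lt => //.
    by move=> x; exact/fejer_saw'_le/ltW.
  by exists 0; rewrite fejer_saw'0 dN.
split=> [lambda l01|lambda l01|n n0].
- apply/eqO_exP; exists (Num.trunc (4 / (1 - lambda))).+1%:R => //.
  near=> n; have n0 : (0 < n)%N by near: n; exact: nbhs_infty_gt.
  rewrite normr_nat ger0_norm ?powR_ge0// /saw_degree natrM mulrC ler_wpM2l//.
  by rewrite -[leLHS]powRr1// ler_powR ?ler1n// lerDl ltW.
- (* [n^-1] from the sup norm, [2 * n `^ (- eps)] from the seminorm. *)
  apply/eqO_exP; exists 3 => //.
  near=> n; have n0 : (0 < n)%N by near: n; exact: nbhs_infty_gt.
  have [d0 dN dm dn _] := saw_slope_bounds R lambda n l01 n0.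
  have [_ sawB saw'B] := saw_bounds R lambda n l01 n0.
  have [l0 l1] := andP l01.
  have m1 : 1 - lambda ^+ 2 <= 1 by rewrite gerBl sqr_ge0.
  have m0 : 0 <= 1 - lambda ^+ 2 by rewrite (le_trans (ltW d0)).
  have lip x y : `|saw lambda n x - saw lambda n y|
      <= (1 - lambda ^+ 2) * `|x - y|.
    exact: derive_lipschitz (is_derive_fejer_saw _ _ _) saw'B x y.
  have eps01 : 0 <= 1 - eps <= 1 by rewrite subr_ge0 gerBl !ltW.
  have /andP[h0] := holder_norm_bounds R _ _ _ _ eps01 m0 sawB lip.
  rewrite !ger0_norm ?powR_ge0//; move=> /le_trans; apply.
  have -> : 1 - (1 - eps) = eps by ring.
  have n1 : n%:R^-1 <= n%:R `^ (- eps) :> R.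
    by rewrite -powR_inv1// ler_powR ?ler1n// lerN2 ltW.
  have npow : (n%:R^-1) `^ eps = n%:R `^ (- eps) :> R.
    by rewrite -powR_inv1// -powRrM mulN1r.
  have : (1 - lambda ^+ 2) `^ (1 - eps) <= 1.
    have e1 : 1 `^ (1 - eps) = 1 :> R by rewrite powR1.
    by rewrite -[leRHS]e1 ge0_ler_powR ?nnegrE// subr_ge0 ltW.
  have : (2 * saw_slope lambda n) `^ eps <= 2 * n%:R `^ (- eps).
    rewrite powRM ?(ltW d0)// -npow ler_pM ?powR_ge0//.
      by rewrite -[leRHS]powRr1// ler_powR ?ler1n// ltW.
    by rewrite ge0_ler_powR ?nnegrE ?invr_ge0 ?(ltW d0) ?(ltW eps0).
  have := powR_ge0 (1 - lambda ^+ 2) (1 - eps).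
  have := powR_ge0 (2 * saw_slope lambda n) eps.
  nra.
- have l2 (lambda : R) : 0 < lambda < 1 -> 1 - lambda ^+ 2 <= 2 * (1 - lambda).
    by case/andP => l0 l1; nra.
  split=> [lambda l01|].
    by have /andP[_ /le_trans] := C1 _ _ l01 n0; apply; rewrite gerBl sqr_ge0.
  apply/eqO_exP; exists 2 => //; near=> lambda.
  have l01 : 0 < lambda < 1.
    apply/andP; split; near: lambda; [exact: nbhs_left_gt|exact: nbhs_left_lt].
  have /andP[c0 cm] := C1 _ _ l01 n0; have [l0 l1] := andP l01.
  by rewrite !ger0_norm ?subr_ge0 ?(ltW l1)// (le_trans cm)// l2.
Unshelve. all: by end_near.
Qed.
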